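(* As formal power series in $z$, $$\sum_{n\ge 1} W^{\ne}_n(\mathbf{x},t) z^n = \frac{\sum_{i\ge 2}\big([i]_t+i\,t\,[i-2]_t\big) e_i(\mathbf{x}) z^i}{1-\sum_{i\ge 2} t[i-1]_t\, e_i(\mathbf{x}) z^i}.$$ Consequently, $W^{\ne}_n(\mathbf{x},t)$ is $e$-positive for all $n\ge 1$.
   Context: For $n\ge 1$, $W_n$ is the set of Smirnov words of length $n$: words $w=w_1\cdots w_n$ over the positive integers with $w_i\ne w_{i+1}$ for all $1\le i\le n-1$. Let $\mathbf{x}=x_1,x_2,\dots$ be indeterminates and $x_w:=x_{w_1}\cdots x_{w_n}$. The descent number is $\mathrm{des}(w):=|\{i\in\{1,\dots,n-1\}: w_i>w_{i+1}\}|$. Define $W^{\ne}_n(\mathbf{x},t):=\sum_{w\in W_n,\,w_1\ne w_n} t^{\mathrm{des}(w)}x_w$. Here $e_i(\mathbf{x})$ is the elementary symmetric function of degree $i$ and $[m]_t:=1+t+\cdots+t^{m-1}$, with $[0]_t=0$. A polynomial in $t$ is $e$-positive if all of its coefficients are symmetric functions whose expansion in the elementary symmetric function basis has nonnegative coefficients. *)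

(* Defs.v *)
From HB Require Import structures.
From mathcomp Require Import all_boot all_order all_algebra finmap monalg zify.
From mathcomp Require Import boolp classical_sets cardinality fsbigop.

Set Implicit Arguments.
Unset Strict Implicit.
Unset Printing Implicit Defensive.

Import GRing.Theory Num.Theory.

Local Open Scope classical_set_scope.
Local Open Scope ring_scope.

(* Formal power series over R in an arbitrary, possibly infinite, family      *)
(* of commuting indeterminates indexed by I: arbitrary (not finitely          *)
(* supported) functions from the monomials {cmonom I} to R. They get the      *)
(* convolution product, hence the wrapper around the function type.           *)
Record mps (I : choiceType) (R : Type) := MPS { mcoef : {cmonom I} -> R }.

Section Splits.
Variable I : choiceType.
Implicit Types m : {cmonom I}.

Definition msplit m : set ({cmonom I} * {cmonom I}) :=
  [set p | mmul p.1 p.2 = m].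

Lemma finite_msplit m : finite_set (msplit m).
Proof.
pose K := finsupp m; pose N := mdeg m.
pose mk (g : {ffun K -> 'I_N.+1}) : {cmonom I} :=
  mkcmonom [fsfun i : K => (g i : nat) | 0%N].
apply: (@sub_finite_set _ _
  ((fun g => (mk g, divcm m (mk g))) @` [set: {ffun K -> 'I_N.+1}])); last first.
  by apply: finite_image; exact: finite_finset.
move=> [a b] /= abm.
have leN i : (a i < N.+1)%N.
  rewrite ltnS /N -abm mdegM; apply: leq_trans (leq_addr _ _).
  have [ia|ia] := finsuppP a i; first by [].
  by rewrite mdegE (big_fsetD1 i) //= leq_addr.
pose g : {ffun K -> 'I_N.+1} := [ffun i : K => Ordinal (leN (val i))].
have gE u : g u = a (val u) :> nat by rewrite ffunE.
exists g => //; rewrite /=; set c := mk _; have -> : c = a.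
  apply/eqP/cmP => i; rewrite /c /mk cmE fsfun_ffun.
  case: insubP => [u _ <-|]; first exact: gE.
  move=> /= iK; have ia : i \notin finsupp a.
    by apply: contra iK => ia; rewrite /K -abm mdomD in_fsetU ia.
  by case: finsuppP ia.
by congr pair; rewrite -abm; apply/eqP/cmP => i; rewrite divcmE mulcmE addKn.
Qed.

Definition msplits m := fset_set (msplit m).

Lemma mem_msplits m p : (p \in msplits m) = (mmul p.1 p.2 == m).
Proof.
rewrite /msplits in_fset_set; last exact: finite_msplit.
by apply/idP/eqP; rewrite inE.
Qed.

End Splits.

Section MPSRing.
Variables (I : choiceType) (R : comNzRingType).
Local Notation mps := (mps I R).
Implicit Types (f g h : mps) (m : {cmonom I}).

HB.instance Definition _ := gen_eqMixin mps.
HB.instance Definition _ := gen_choiceMixin mps.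

Lemma mpsP f g : (forall m, mcoef f m = mcoef g m) -> f = g.
Proof. by case: f g => f [g] /= /funext ->. Qed.

Definition mps_zero : mps := MPS (fun=> 0).
Definition mps_one : mps := MPS (fun m => (m == mone)%:R).
Definition mps_add f g : mps := MPS (fun m => mcoef f m + mcoef g m).
Definition mps_opp f : mps := MPS (fun m => - mcoef f m).
Definition mps_mul f g : mps :=
  MPS (fun m => \sum_(p \in msplit m) mcoef f p.1 * mcoef g p.2).

Lemma mps_mulE f g m :
  mcoef (mps_mul f g) m = \sum_(p <- msplits m) mcoef f p.1 * mcoef g p.2.
Proof. by rewrite /= fsbig_finite //; exact: finite_msplit. Qed.

Fact mps_addA : associative mps_add.
Proof. by move=> f g h; apply: mpsP => m /=; rewrite addrA. Qed.
Fact mps_addC : commutative mps_add.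
Proof. by move=> f g; apply: mpsP => m /=; rewrite addrC. Qed.
Fact mps_add0 : left_id mps_zero mps_add.
Proof. by move=> f; apply: mpsP => m /=; rewrite add0r. Qed.
Fact mps_addN : left_inverse mps_zero mps_opp mps_add.
Proof. by move=> f; apply: mpsP => m /=; rewrite addNr. Qed.

HB.instance Definition _ :=
  GRing.isZmodule.Build mps mps_addA mps_addC mps_add0 mps_addN.

Fact mps_mulC : commutative mps_mul.
Proof.
move=> f g; apply: mpsP => m; rewrite !mps_mulE.
pose sw (p : {cmonom I} * {cmonom I}) := (p.2, p.1).
have swI : injective sw by move=> [a b] [c d] [-> ->].
rewrite (perm_big [seq sw p | p <- msplits m]) /=; last first.
  apply: uniq_perm; rewrite ?fset_uniq ?map_inj_uniq ?fset_uniq // => -[a b].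
  rewrite (mem_map swI (msplits m) (b, a)) !mem_msplits /=.
  by rewrite mulmC.
by rewrite big_map; apply: eq_bigr => p _; rewrite mulrC.
Qed.

Fact mps_mulA : associative mps_mul.
Proof.
move=> f g h; apply: mpsP => m; rewrite !mps_mulE.
under eq_bigr do rewrite mps_mulE mulr_sumr.
under [RHS]eq_bigr do rewrite mps_mulE mulr_suml.
pose T := ({cmonom I} * {cmonom I})%type.
rewrite -(@big_allpairs_dep _ _ _ _ _ _ (fun p q : T => (p, q)) _
   (fun p => msplits p.2)
   (fun u : T * T => mcoef f u.1.1 * (mcoef g u.2.1 * mcoef h u.2.2))) /=.
rewrite -(@big_allpairs_dep _ _ _ _ _ _ (fun p q : T => (p, q)) _
   (fun p => msplits p.1)
   (fun u : T * T => mcoef f u.2.1 * mcoef g u.2.2 * mcoef h u.1.2)) /=.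
pose phi (u : T * T) : T * T :=
  ((u.2.1, mmul u.2.2 u.1.2), (u.2.2, u.1.2)).
set s2 := (X in _ = \sum_(i <- X) _).
have us2 : uniq s2.
  apply: allpairs_uniq_dep => [|p _|]; rewrite ?fset_uniq //.
  by move=> [p q] [p' q'] _ _ /= [-> ->].
have ms2 u : (u \in s2) = (mmul u.1.1 u.1.2 == m) && (mmul u.2.1 u.2.2 == u.1.1).
  case: u => p q; apply/allpairsPdep/andP => /=.
    by move=> [p' [q' [+ + [-> ->]]]]; rewrite !mem_msplits => -> ->.
  by case=> *; exists p, q; rewrite !mem_msplits.
rewrite (perm_big (map phi s2)) /=.
  by rewrite big_map; apply: eq_bigr => u _; rewrite mulrA.
have phiI : {in s2 &, injective phi}.
  move=> [[a b] [c d]] [[a' b'] [c' d']]; rewrite !ms2 /=.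
  by move=> /andP[_ /eqP <-] /andP[_ /eqP <-] [-> _ -> ->].
apply: uniq_perm; last 1 first.
- move=> [[a b] [c d]]; apply/allpairsPdep/mapP => /=.
    move=> [[a' b'] [[c' d'] [+ + [-> -> -> ->]]]]; rewrite !mem_msplits /=.
    move=> /eqP abm /eqP cdb; exists ((mmul a' c', d'), (a', c')).
      by rewrite ms2 /= eqxx -mulmA cdb abm eqxx.
    by rewrite /phi /= cdb.
  move=> [[[a' b'] [c' d']]]; rewrite ms2 /= => /andP[/eqP abm /eqP cda].
  move=> [-> -> -> ->]; exists (c', mmul d' b'), (d', b').
  by rewrite !mem_msplits /= eqxx mulmA cda abm eqxx.
- apply: allpairs_uniq_dep => [|p _|]; rewrite ?fset_uniq //.
  by move=> [p q] [p' q'] _ _ /= [-> ->].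
- by rewrite map_inj_in_uniq.
Qed.

Fact mps_mul1 : left_id mps_one mps_mul.
Proof.
move=> f; apply: mpsP => m; rewrite mps_mulE.
rewrite (bigD1_seq (mone, m)) ?fset_uniq ?mem_msplits ?mul1m //=.
rewrite eqxx mul1r big1_seq ?addr0 // => -[a b]; rewrite mem_msplits /=.
case/andP=> + /eqP abm; case: (eqVneq a mone) => [a1|]; last by rewrite mul0r.
by rewrite -abm a1 mul1m eqxx.
Qed.

Fact mps_mulDl : left_distributive mps_mul mps_add.
Proof.
move=> f g h; apply: mpsP => m.
transitivity (mcoef (mps_mul f h) m + mcoef (mps_mul g h) m) => //.
by rewrite !mps_mulE -big_split; apply: eq_bigr => p _; rewrite mulrDl.
Qed.

Fact mps_1neq0 : mps_one != 0.
Proof.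
apply/eqP => /(congr1 (fun f => mcoef f mone)) /=.
by rewrite eqxx => /eqP; rewrite oner_eq0.
Qed.

HB.instance Definition _ := GRing.Zmodule_isComNzRing.Build mps
  mps_mulA mps_mulC mps_mul1 mps_mulDl mps_1neq0.

End MPSRing.

Record fps (R : Type) := FPS { fcoef : nat -> R }.

Section FPSRing.
Variable R : comNzRingType.
Local Notation fps := (fps R).
Implicit Types f g h : fps.

HB.instance Definition _ := gen_eqMixin fps.
HB.instance Definition _ := gen_choiceMixin fps.

Lemma fpsP f g : (forall n, fcoef f n = fcoef g n) -> f = g.
Proof. by case: f g => f [g] /= /funext ->. Qed.

Definition fps_zero : fps := FPS (fun=> 0).
Definition fps_one : fps := FPS (fun n => (n == 0%N)%:R).
Definition fps_add f g : fps := FPS (fun n => fcoef f n + fcoef g n).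
Definition fps_opp f : fps := FPS (fun n => - fcoef f n).
Definition fps_mul f g : fps :=
  FPS (fun n => \sum_(i < n.+1) fcoef f i * fcoef g (n - i)).

Fact fps_addA : associative fps_add.
Proof. by move=> f g h; apply: fpsP => m /=; rewrite addrA. Qed.
Fact fps_addC : commutative fps_add.
Proof. by move=> f g; apply: fpsP => m /=; rewrite addrC. Qed.
Fact fps_add0 : left_id fps_zero fps_add.
Proof. by move=> f; apply: fpsP => m /=; rewrite add0r. Qed.
Fact fps_addN : left_inverse fps_zero fps_opp fps_add.
Proof. by move=> f; apply: fpsP => m /=; rewrite addNr. Qed.

HB.instance Definition _ :=
  GRing.isZmodule.Build fps fps_addA fps_addC fps_add0 fps_addN.

Let trunc N f : {poly R} := \poly_(i < N.+1) fcoef f i.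

Let fps_mul_trunc N f g n : (n <= N)%N ->
  fcoef (fps_mul f g) n = (trunc N f * trunc N g)`_n.
Proof.
move=> leN; rewrite coefM; apply: eq_bigr => i _; rewrite !coef_poly !ltnS.
by rewrite (leq_trans (leq_ord i) leN) (leq_trans (leq_subr _ _) leN).
Qed.

Let coefM_trunc (p q p' q' : {poly R}) n :
  (forall i, (i <= n)%N -> p`_i = p'`_i) ->
  (forall i, (i <= n)%N -> q`_i = q'`_i) -> (p * q)`_n = (p' * q')`_n.
Proof.
move=> pE qE; rewrite !coefM; apply: eq_bigr => i _.
by rewrite pE ?leq_ord // qE ?leq_subr.
Qed.

Let coef_trunc N f n : (n <= N)%N -> (trunc N f)`_n = fcoef f n.
Proof. by move=> leN; rewrite coef_poly ltnS leN. Qed.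

Fact fps_mulC : commutative fps_mul.
Proof. by move=> f g; apply: fpsP => n; rewrite !(@fps_mul_trunc n) // mulrC. Qed.

Fact fps_mulA : associative fps_mul.
Proof.
move=> f g h; apply: fpsP => n; rewrite !(@fps_mul_trunc n) //.
rewrite (@coefM_trunc _ _ (trunc n f) (trunc n g * trunc n h)) => [|//|i leN].
  rewrite mulrA; apply: coefM_trunc => // i leN.
  by rewrite coef_trunc // (fps_mul_trunc _ _ leN).
by rewrite coef_trunc // (fps_mul_trunc _ _ leN).
Qed.

Fact fps_mul1 : left_id fps_one fps_mul.
Proof.
move=> f; apply: fpsP => n /=.
rewrite big_ord_recl /= mul1r subn0 big1 ?addr0 // => i _.
by rewrite mul0r.
Qed.

Fact fps_mulDl : left_distributive fps_mul fps_add.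
Proof.
move=> f g h; apply: fpsP => n /=; rewrite -big_split.
by apply: eq_bigr => i _; rewrite mulrDl.
Qed.

Fact fps_1neq0 : fps_one != 0.
Proof.
apply/eqP => /(congr1 (fun f => fcoef f 0%N)) /=.
by move/eqP; rewrite oner_eq0.
Qed.

HB.instance Definition _ := GRing.Zmodule_isComNzRing.Build fps
  fps_mulA fps_mulC fps_mul1 fps_mulDl fps_1neq0.

Lemma fcoefB f g n : fcoef (f - g) n = fcoef f n - fcoef g n.
Proof. by []. Qed.

Lemma fcoefM f g n :
  fcoef (f * g) n = \sum_(i < n.+1) fcoef f i * fcoef g (n - i).
Proof. by []. Qed.

Lemma fcoef_sum (J : Type) (s : seq J) (F : J -> fps) n :
  fcoef (\sum_(j <- s) F j) n = \sum_(j <- s) fcoef (F j) n.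
Proof. by elim/big_rec2: _ => // j x y _ <-. Qed.

(* The sum over i >= a of F i * z ^ i. *)
Definition series_from (a : nat) (F : nat -> R) : fps :=
  FPS (fun i => if (a <= i)%N then F i else 0).

(* The inverse of a series d with constant term 1, as the geometric series    *)
(* of 1 - d: only the powers k <= n contribute to the coefficient of z ^ n.   *)
Definition fpsV (d : fps) : fps :=
  FPS (fun n => \sum_(k < n.+1) fcoef ((1 - d) ^+ k) n).

Lemma fcoef_exp_lt u k n : fcoef u 0 = 0 -> (n < k)%N -> fcoef (u ^+ k) n = 0.
Proof.
move=> u0; elim: k n => // k IHk n; rewrite ltnS exprS fcoefM => le_nk.
rewrite big1 // => -[[|i] /= lt_in] _; first by rewrite u0 mul0r.
by rewrite IHk ?mulr0 //; apply: leq_trans le_nk; rewrite ltn_subrL; case: n lt_in.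
Qed.

Lemma fpsVP d : fcoef d 0 = 1 -> d * fpsV d = 1.
Proof.
move=> d1; pose u := 1 - d.
have u0 : fcoef u 0 = 0 by rewrite fcoefB d1 subrr.
apply: fpsP => n.
have -> : fcoef (d * fpsV d) n = fcoef (d * \sum_(k < n.+1) u ^+ k) n.
  rewrite !fcoefM; apply: eq_bigr => i _; congr (_ * _).
  rewrite fcoef_sum /= (big_ord_widen n.+1 (fun k => fcoef (u ^+ k) (n - i))).
    rewrite big_mkcond; apply: eq_bigr => k _; case: ltnP => // ltk.
    by rewrite fcoef_exp_lt.
  by rewrite ltnS leq_subr.
rewrite (_ : d = - (u - 1)); last by rewrite /u addrAC subrr add0r opprK.
by rewrite mulNr -subrX1 opprB fcoefB fcoef_exp_lt ?subr0.
Qed.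

End FPSRing.

Section SymmetricFunctions.
Variable I : choiceType.
Local Notation Lam := (mps I int).

Definition elemsym (k : nat) : Lam :=
  MPS (fun m => ((mdeg m == k) && all (fun i => m i == 1%N) (finsupp m))%:R).

Definition is_partition (la : seq nat) := sorted geq la && all (leq 1) la.

Definition elemsym_part (la : seq nat) : Lam := \prod_(k <- la) elemsym k.

(* The second condition is invariance under the permutations s of the         *)
(* indeterminates: m' is m with every x_i renamed to x_(s i).                 *)
Definition symmetric_function (f : Lam) : Prop :=
  (exists d : nat, forall m, (d < mdeg m)%N -> mcoef f m = 0) /\
  (forall s : I -> I, bijective s ->
     forall m m' : {cmonom I}, (forall i, m' (s i) = m i) ->
     mcoef f m' = mcoef f m).

Definition e_positive (f : Lam) : Prop :=
  symmetric_function f /\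
  exists (parts : seq (seq nat)) (c : seq nat -> int),
    [/\ uniq parts, all is_partition parts,
        (forall la, la \in parts -> 0 <= c la)
      & f = \sum_(la <- parts) elemsym_part la *~ c la].

Definition poly_e_positive (P : {poly Lam}) : Prop := forall j, e_positive P`_j.

End SymmetricFunctions.

Arguments elemsym I k : clear implicits.
Arguments elemsym_part I la : clear implicits.

(* [m]_t, where t is the indeterminate 'X. *)
Definition tnum (R : nzRingType) (m : nat) : {poly R} := \sum_(k < m) 'X^k.

Definition letter := {i : nat | (0 < i)%N}.

Local Notation Lam := (mps letter int).

Definition xmon (w : seq letter) : {cmonom letter} :=
  \big[mmul/mone]_(a <- w) ucm a.

Definition des (w : seq letter) : nat :=
  count (fun p => (val p.2 < val p.1)%N) (zip w (behead w)).

Definition smirnov (n : nat) (w : seq letter) : bool :=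
  (size w == n) && sorted (fun a b => a != b) w.

Definition ends_differ (w : seq letter) : bool :=
  if w is a :: u then a != last a u else false.

(* The coefficient of t ^ j in W^{<>}_n is the sum of the x_w over the w with *)
(* des w = j, whose coefficient of a monomial m is the number of such w with  *)
(* x_w = m; des w < n for a nonempty word of length n.                        *)
Definition Wne (n : nat) : {poly Lam} :=
  \poly_(j < n) MPS (fun m =>
    \sum_(w \in [set w | [/\ smirnov n w, ends_differ w, des w = j & xmon w = m]])
      (1 : int)).

Lemma finite_xmon (m : {cmonom letter}) : finite_set [set w | xmon w = m].
Proof.
pose K := finsupp m.
apply: (@sub_finite_set _ _
  ((fun t : (mdeg m).-tuple K => map val t) @` setT)); last first.
  by apply: finite_image; exact: finite_finset.
move=> w /= wm.
have sw : size w == mdeg m.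
  by rewrite -wm /xmon mdeg_prod (eq_bigr (fun=> 1%N)) ?sum1_size // => i _; rewrite mdegU.
have wK : {subset w <= K}.
  move=> a; rewrite /K -{m K sw}wm; elim: w => // b w IHw.
  rewrite /xmon big_cons mdomD inE in_fsetU mdomU in_fset1.
  by case/orP => [->//|/IHw ->]; rewrite orbT.
pose u := pmap (insub : letter -> option K) w.
have vu : map val u = w.
  rewrite /u; elim: w wK {wm sw u} => //= a w IHw wK.
  rewrite insubT /=; first by apply: wK; rewrite inE eqxx.
  by move=> aK; rewrite IHw // => b bw; apply: wK; rewrite inE bw orbT.
have su : size u == mdeg m by rewrite -(size_map val) vu.
by exists (Tuple su).
Qed.

Lemma des_lt n w : (0 < n)%N -> size w = n -> (des w < n)%N.
Proof.
move=> n_gt0 sw; apply: leq_ltn_trans (count_size _ _) _.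
by rewrite size_zip size_behead sw; lia.
Qed.

Lemma coef_Wne n j m : (0 < n)%N ->
  mcoef (Wne n)`_j m =
  \sum_(w \in [set w | [/\ smirnov n w, ends_differ w, des w = j & xmon w = m]]) 1 :> int.
Proof.
move=> n_gt0; rewrite coef_poly; case: ltnP => // le_nj.
rewrite fsbig1 // => w [/andP[/eqP sw _] _ dw _].
by have := des_lt n_gt0 sw; rewrite dw ltnNge le_nj.
Qed.

(* Main.v *)
(* Transfer matrix over a finite alphabet [{0, .., N - 1}] with weights        *)
(* [Y a = y a * z]. The generating series [u a] of the Smirnov words starting *)
(* with [a] satisfy a linear system whose kernel is constant above and below  *)
(* the diagonal, so that the prefix sums of [u] obey a first order recurrence *)
(* solved by [E = sum_i e_i z^i] and [P = sum_i [i]_t e_i z^i]. With          *)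
(* [D = E - P = 1 - sum_i t [i-1]_t e_i z^i] this gives [P / D] for all       *)
(* Smirnov words and [Y c * D_c / D] for those starting and ending with [c],  *)
(* where [D_c] is [D] at [y c = 0]. Since the sum over [c] of                 *)
(* [y c * e_i(y c = 0)] is [(i + 1) e_(i+1)], subtracting the latter series   *)
(* from the former gives the numerator. The infinite alphabet follows because *)
(* a series is determined by its images when all but N letters are set to 0,  *)
(* and e-positivity is read off the recurrence given by the denominator.      *)

From HB Require Import structures.
Require Import Defs.
From mathcomp Require Import all_boot all_order all_algebra.
From mathcomp Require Import finmap monalg zify ring.
From mathcomp Require Import boolp classical_sets fsbigop.

Set Implicit Arguments.
Unset Strict Implicit.
Unset Printing Implicit Defensive.

Import GRing.Theory.

Local Open Scope ring_scope.

(** * Smirnov systems *)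

Section TransferMatrix.
Variables (B : comNzRingType) (t : B).
Implicit Types (Y u f : nat -> B).

(** The words with distinct ends are all Smirnov words minus those that start and end with the same
    letter; both classes are counted by their first letter. Prepending a letter gives a linear
    system ([smirnov_system]). Write E_a, T_a for [prod1D Y a], [tprod Y a], U_a for the sum of the
    first a unknowns, and S for their total. Then X_a = E_a U_a obeys X_{a+1} = (1 + t Y_a) X_a + K
    Y_a E_a, with K = 1 + S for all words; for words ending in c, K = S and there is one extra
    source at c. Since T_a solves this with K = 1, setting a = N yields [smirnov_system_total] and
    [smirnov_system_diag], both with denominator E_N - T_N.

    With Y_a = y_a z, [ends_differ_seriesM] subtracts the two, and [sum_elem_sym_delete] produces
    the factor i in the numerator. [trunc_Wne] and [trunc_elemsym] identify this with the truncation
    of the claim to N letters, and [fps_ptrunc_inj] removes the truncation.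

    For positivity, clearing the denominator gives the subtraction-free recurrence [Wne_rec], and
    induction on n applies. *)

Fixpoint prod1D Y a : B := if a is a'.+1 then (1 + Y a') * prod1D Y a' else 1.

(* With [e_i] the elementary symmetric functions of [Y 0, .., Y (a - 1)],     *)
(* [prod1D] is the sum of the [e_i] and [tprod] is the sum of the [[i]_t e_i]. *)
Fixpoint tprod Y a : B :=
  if a is a'.+1 then tprod Y a' + Y a' * (prod1D Y a' + t * tprod Y a') else 0.

(** [u a] stands for the words starting with [a]: the one-letter word, of weight [f a], or [a]
    followed by a word starting with some [b != a], with a factor [t] for the descent when
    [b < a]. *)
Definition smirnov_system Y N f u := forall a, (a < N)%N ->
  u a = f a + Y a * \sum_(b < N | b != a :> nat) (if (b < a)%N then t else 1) * u b.

(** The kernel is 1 off the diagonal plus a correction t - 1 below it, so only the total and one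
    prefix sum survive. *)
Lemma sum_kernel N u a : (a < N)%N ->
  \sum_(b < N | b != a :> nat) (if (b < a)%N then t else 1) * u b =
  \sum_(b < N) u b - u a + (t - 1) * \sum_(b < a) u b.
Proof.
move=> aN; rewrite [\sum_(b < N) u b](bigD1 (Ordinal aN)) //= [u a + _]addrC addrK.
rewrite (big_ord_widen N u (ltnW aN)) big_distrr /= [X in _ + X]big_mkcond /=.
rewrite [X in _ + X](bigD1 (Ordinal aN)) //= ltnn add0r -big_split /=.
by apply: eq_bigr => b _; case: ifP => _; ring.
Qed.

Lemma smirnov_system_step Y N f u a : smirnov_system Y N f u -> (a < N)%N ->
  (1 + Y a) * u a =
  f a + Y a * (\sum_(b < N) u b + (t - 1) * \sum_(b < a) u b).
Proof. by move=> sys aN; rewrite mulrDl mul1r {1}(sys _ aN) sum_kernel //; ring. Qed.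

Lemma smirnov_system_total Y N u : smirnov_system Y N Y u ->
  (prod1D Y N - tprod Y N) * \sum_(a < N) u a = tprod Y N.
Proof.
move=> sys; set S := \sum_(a < N) u a.
(* Multiplying by [prod1D] absorbs the factor [1 + Y a] of the step equation, so nothing has to be
   divided. *)
have prefix a : (a <= N)%N ->
    prod1D Y a * \sum_(b < a) u b = (1 + S) * tprod Y a.
  elim: a => [|a IHa] aN /=; first by rewrite big_ord0; ring.
  rewrite big_ord_recr /= mulrDr -[X in _ + X]mulrA mulrCA.
  rewrite [_ * u a](smirnov_system_step sys aN) -/S.
  rewrite -mulrA IHa ?(ltnW aN) // !mulrDr; ring: (IHa (ltnW aN)).
by rewrite mulrBl prefix // -/S; ring.
Qed.

Definition delete Y c : nat -> B := fun a => if a == c then 0 else Y a.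

Lemma prod1D_delete Y c N : prod1D Y N =
  (if (c < N)%N then 1 + Y c else 1) * prod1D (delete Y c) N.
Proof.
elim: N => [|N IHN] /=; first by rewrite mul1r.
rewrite IHN /delete; case: (ltngtP N c) => [ltNc|ltcN|->].
- by rewrite ltnS leqNgt ltNc /=; ring.
- by rewrite ltnS (ltnW ltcN); ring.
- by rewrite ltnSn; ring.
Qed.

Lemma tprod_delete Y c N : tprod Y N = tprod (delete Y c) N +
  (if (c < N)%N then Y c else 0) *
  (prod1D (delete Y c) N + t * tprod (delete Y c) N).
Proof.
elim: N => [|N IHN] /=; first by ring.
rewrite IHN (prod1D_delete Y c) /delete; case: (ltngtP N c) => [ltNc|ltcN|->].
- by rewrite ltnS leqNgt ltNc /=; ring.
- by rewrite ltnS (ltnW ltcN); ring.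
- by rewrite ltnSn; ring.
Qed.

(** This is 1 + (t - 1)[i]_t = t^i, summed against the e_i. *)
Lemma prod1DB_tprod Y N :
  prod1D Y N + (t - 1) * tprod Y N = \prod_(a < N) (1 + t * Y a).
Proof.
elim: N => [|N IHN] /=; first by rewrite big_ord0; ring.
by rewrite big_ord_recr /= -IHN; ring.
Qed.

Lemma prod_delete Y c N : (c < N)%N ->
  \prod_(a < N) (1 + t * delete Y c a) =
  \prod_(a < c) (1 + t * Y a) * \prod_(c.+1 <= a < N) (1 + t * Y a).
Proof.
move=> cN; rewrite -(big_mkord xpredT (fun a => 1 + t * delete Y c a)).
rewrite (big_cat_nat (leq0n c) (ltnW cN)) /= [X in _ * X]big_ltn //.
rewrite {2}/delete eqxx mulr0 addr0 mul1r -(big_mkord xpredT (fun a => 1 + t * Y a)).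
congr (_ * _); apply: eq_big_nat => a /andP[lb ub]; rewrite /delete ifN //; lia.
Qed.

(** The source sits at [c] alone: the prefix sums are driven by S before [c], pick up
    [Y c * prod1D Y c] there, and this extra term is multiplied by [1 + t * Y b] at each later [b].
    The identity is proved up to the factor [prod1D Y c * (1 + Y c)], which regularity cancels. *)
Lemma smirnov_system_diag Y N c u : (c < N)%N ->
  smirnov_system Y N (fun a => if a == c then Y c else 0) u ->
  GRing.lreg (prod1D Y c) -> GRing.lreg (1 + Y c) ->
  (prod1D Y N - tprod Y N) * u c =
  Y c * (prod1D (delete Y c) N - tprod (delete Y c) N).
Proof.
move=> cN sys regE reg1Y; set S := \sum_(a < N) u a.
have before a : (a <= c)%N -> prod1D Y a * \sum_(b < a) u b = S * tprod Y a.
  elim: a => [|a IHa] ac /=; first by rewrite big_ord0; ring.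
  rewrite big_ord_recr /= mulrDr -[X in _ + X]mulrA mulrCA.
  rewrite [_ * u a](smirnov_system_step sys) ?(ltn_trans ac) // -/S.
  by rewrite (ltn_eqF ac); ring: (IHa (ltnW ac)).
have after a : (a <= N)%N -> (c < a)%N -> prod1D Y a * \sum_(b < a) u b =
    S * tprod Y a + Y c * prod1D Y c * \prod_(c.+1 <= b < a) (1 + t * Y b).
  elim: a => [//|a IHa] aN; rewrite ltnS leq_eqVlt => /orP[/eqP ca|ca] /=.
    rewrite -ca big_ord_recr /= mulrDr -[X in _ + X]mulrA mulrCA.
    rewrite [_ * u c](smirnov_system_step sys) // -/S eqxx big_geq //.
    by ring: (before c (leqnn c)).
  rewrite big_nat_recr //= big_ord_recr /= mulrDr -[X in _ + X]mulrA mulrCA.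
  rewrite [_ * u a](smirnov_system_step sys) // -/S (gtn_eqF ca).
  by ring: (IHa (ltnW aN) ca).
have := smirnov_system_step sys cN; rewrite eqxx -/S => step.
have := after N (leqnn N) cN; rewrite -/S => total.
have := before c (leqnn c) => pre.
set X := \prod_(c.+1 <= b < N) _ in total.
(* The letters before [c] complete [X] to the product over all letters other than [c]. *)
have telX : \prod_(a < c) (1 + t * Y a) * X =
    prod1D (delete Y c) N + (t - 1) * tprod (delete Y c) N.
  by rewrite prod1DB_tprod prod_delete.
rewrite -(prod1DB_tprod Y c) in telX.
apply: reg1Y; apply: regE.
have -> : prod1D Y c * ((1 + Y c) * ((prod1D Y N - tprod Y N) * u c)) =
    prod1D Y c * (prod1D Y N - tprod Y N) * ((1 + Y c) * u c) by ring.
rewrite step.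
have -> : prod1D Y c * (prod1D Y N - tprod Y N) *
    (Y c + Y c * (S + (t - 1) * \sum_(b < c) u b)) =
  Y c * prod1D Y c * ((prod1D Y N - tprod Y N)
    + Y c * (((prod1D Y c + (t - 1) * tprod Y c)) * X)).
  have DS : (prod1D Y N - tprod Y N) * S = Y c * prod1D Y c * X.
    by rewrite mulrBl total; ring.
  transitivity (Y c * (prod1D Y N - tprod Y N) *
      (prod1D Y c * (1 + S) + (t - 1) * (prod1D Y c * \sum_(b < c) u b))).
    by ring.
  rewrite pre; transitivity (Y c * (prod1D Y c * (prod1D Y N - tprod Y N) +
      (prod1D Y N - tprod Y N) * S * (prod1D Y c + (t - 1) * tprod Y c))).
    by ring.
  by rewrite DS; ring.
(* With E', T' the values for [delete Y c], the bracket becomes (1 + Y c)(E' - T'). *)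
by rewrite telX (prod1D_delete Y c N) (tprod_delete Y c N) cN; ring.
Qed.

End TransferMatrix.

(** * Generating series over a finite alphabet *)

Section FiniteAlphabet.
Variables (R : comNzRingType) (t : R).
Implicit Types (y f : nat -> R) (g h : fps R).

Lemma fps_lreg g : fcoef g 0 = 1 -> GRing.lreg g.
Proof.
move=> g1 h k eq_gh; rewrite -[h]mul1r -[k]mul1r -(fpsVP g1).
by rewrite ![_ * fpsV _]mulrC -!mulrA eq_gh.
Qed.

Definition fpsC (c : R) : fps R := FPS (fun n => if n is 0 then c else 0).
Definition fpsZ (c : R) : fps R := FPS (fun n => if n is 1 then c else 0).

Lemma fcoefCM c g n : fcoef (fpsC c * g) n = c * fcoef g n.
Proof.
by rewrite fcoefM big_ord_recl /= subn0 big1 ?addr0 // => i _; rewrite mul0r.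
Qed.

Lemma fcoefZM c g n :
  fcoef (fpsZ c * g) n = if n is n'.+1 then c * fcoef g n' else 0.
Proof.
rewrite fcoefM big_ord_recl /= mul0r add0r.
case: n => [|n]; first by rewrite big_ord0.
by rewrite big_ord_recl /= subSS subn0 big1 ?addr0 // => i _; rewrite mul0r.
Qed.

Lemma fcoefD g h n : fcoef (g + h) n = fcoef g n + fcoef h n.
Proof. by []. Qed.

Lemma fcoef_sum_cond (J : Type) (s : seq J) (P : pred J) (F : J -> fps R) n :
  fcoef (\sum_(j <- s | P j) F j) n = \sum_(j <- s | P j) fcoef (F j) n.
Proof. by elim/big_rec2: _ => // j x h _ <-. Qed.

Definition qnum n : R := \sum_(k < n) t ^+ k.

Lemma qnumS n : qnum n.+1 = 1 + t * qnum n.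
Proof.
rewrite /qnum big_ord_recl expr0 big_distrr; congr (_ + _).
by apply: eq_bigr => i _; rewrite exprS.
Qed.

Fixpoint elem_sym y N k : R :=
  match N, k with
  | _, 0 => 1
  | 0, _.+1 => 0
  | N'.+1, k'.+1 => elem_sym y N' k'.+1 + y N' * elem_sym y N' k'
  end.

Lemma elem_sym0 y N : elem_sym y N 0 = 1. Proof. by case: N. Qed.

Lemma eq_elem_sym y y' N k : (forall a, (a < N)%N -> y a = y' a) ->
  elem_sym y N k = elem_sym y' N k.
Proof.
elim: N k => [|N IHN] [|k] //= eqy.
by rewrite eqy // !IHN // => a aN; apply: eqy; rewrite ltnW.
Qed.

(** Both sides enumerate the sets of k + 1 letters with one distinguished element [c]. *)
Lemma sum_elem_sym_delete y N k :
  \sum_(c < N) y c * elem_sym (delete y c) N k = elem_sym y N k.+1 *+ k.+1.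
Proof.
elim: N k => [|N IHN] k; first by rewrite big_ord0 mul0rn.
have delN j : elem_sym (delete y N) N j = elem_sym y N j.
  by apply: eq_elem_sym => a aN; rewrite /delete (ltn_eqF aN).
rewrite big_ord_recr.
have splitS c : (c < N)%N -> y c * elem_sym (delete y c) N.+1 k =
    y c * elem_sym (delete y c) N k +
    (if k is k'.+1 then y N * (y c * elem_sym (delete y c) N k') else 0).
  move=> cN; case: k => [|k] /=; first by rewrite elem_sym0 addr0.
  by rewrite {2}/delete (gtn_eqF cN); ring.
rewrite (eq_bigr _ (fun (c : 'I_N) _ => splitS c (ltn_ord c))).
rewrite big_split /= IHN; case: k {splitS} => [|k].
  by rewrite big1_eq !elem_sym0; ring.
by rewrite -big_distrr /= IHN !delN {1}/delete eqxx; ring.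
Qed.

Lemma prod1D_elem_sym y N : prod1D (fpsZ \o y) N = FPS (elem_sym y N).
Proof.
elim: N => [|N IHN]; first by apply: fpsP => -[|k].
rewrite /= IHN mulrDl mul1r; apply: fpsP => k; rewrite fcoefD fcoefZM.
by case: k => [|k] //=; rewrite elem_sym0 addr0.
Qed.

Lemma tprod_elem_sym y N :
  tprod (fpsC t) (fpsZ \o y) N = FPS (fun k => qnum k * elem_sym y N k).
Proof.
elim: N => [|N IHN].
  by apply: fpsP => -[|k] /=; rewrite ?mulr0 // /qnum big_ord0 mul0r.
rewrite /= prod1D_elem_sym IHN; apply: fpsP => k; rewrite fcoefD fcoefZM.
case: k => [|k]; first by rewrite /= elem_sym0 addr0.
by rewrite fcoefD fcoefCM /= qnumS; ring.
Qed.

Definition smirnov_den y N : fps R :=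
  1 - series_from 2 (fun i => t * qnum (i - 1) * elem_sym y N i).

Definition smirnov_num y N : fps R :=
  series_from 2 (fun i => (qnum i + i%:R * t * qnum (i - 2)) * elem_sym y N i).

(** For i >= 1 one has 1 - [i]_t = -t[i-1]_t, which vanishes at i = 1; hence the start in degree
    2. *)
Lemma prod1DB_tprod_elem_sym y N :
  prod1D (fpsZ \o y) N - tprod (fpsC t) (fpsZ \o y) N = smirnov_den y N.
Proof.
rewrite prod1D_elem_sym tprod_elem_sym; apply: fpsP => -[|[|k]].
- by rewrite !fcoefB /= /qnum big_ord0 !elem_sym0; ring.
- by rewrite !fcoefB /= /qnum big_ord1; ring.
- by rewrite !fcoefB /= subn1 (qnumS k.+1); ring.
Qed.

(* Weighted Smirnov words of length [n.+1] over [{0, .., N - 1}] that start   *)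
(* with [a]; the last letter [b] has weight [f b] instead of [y b].           *)
Fixpoint word_sum f y N n a : R :=
  if n is n'.+1 then
    y a * \sum_(b < N | b != a :> nat) (if (b < a)%N then t else 1) * word_sum f y N n' b
  else f a.

Definition word_series f y N a : fps R :=
  FPS (fun n => if n is n'.+1 then word_sum f y N n' a else 0).

Lemma word_system f y N :
  smirnov_system (fpsC t) (fpsZ \o y) N (fpsZ \o f) (word_series f y N).
Proof.
move=> a aN; apply: fpsP => n; rewrite fcoefD fcoefZM.
case: n => [|n]; first by rewrite addr0.
rewrite fcoef_sum_cond (eq_bigr (fun b : 'I_N =>
    (if (b < a)%N then t else 1) * fcoef (word_series f y N b) n)).
  case: n => [|n]; last by rewrite add0r.
  by rewrite big1 ?mulr0 ?addr0 // => b _; rewrite mulr0.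
by move=> b _; case: ifP => _; rewrite ?fcoefCM ?mul1r.
Qed.

(** As the weight of the last letter, it keeps only the words ending in [c]. *)
Definition single y c : nat -> R := fun a => if a == c then y c else 0.

Definition ends_differ_series y N : fps R :=
  \sum_(a < N) word_series y y N a - \sum_(c < N) word_series (single y c) y N c.

Lemma ends_differ_seriesM y N :
  ends_differ_series y N * smirnov_den y N = smirnov_num y N.
Proof.
rewrite mulrC -prod1DB_tprod_elem_sym mulrBr.
rewrite (smirnov_system_total (@word_system y y N)) [X in _ - X]big_distrr /=.
transitivity (tprod (fpsC t) (fpsZ \o y) N -
    \sum_(c < N) fpsZ (y c) * smirnov_den (delete y c) N).
  congr (_ - _); apply: eq_bigr => c _.
  have Zdel : delete (fpsZ \o y) c = fpsZ \o delete y c.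
    apply: funext => a; rewrite /delete /=; case: ifP => // _.
    by apply: fpsP => -[|[]].
  rewrite -prod1DB_tprod_elem_sym -Zdel.
  apply: smirnov_system_diag => //.
  - suff -> : (fun a : nat => if a == c :> nat then (fpsZ \o y) c else 0) = fpsZ \o single y c.
      exact: word_system.
    apply: funext => a; rewrite /single /=; case: ifP => // _.
    by apply: fpsP => -[|[]].
  - by apply: fps_lreg; rewrite prod1D_elem_sym /= elem_sym0.
  - by apply: fps_lreg; rewrite fcoefD /= addr0.
rewrite tprod_elem_sym; apply: fpsP => k; rewrite fcoefB fcoef_sum.
under eq_bigr => c _ do rewrite fcoefZM.
case: k => [|k]; first by rewrite /= big1_eq /qnum big_ord0 mul0r subr0.
(* The scalar is the coefficient of e_k in the denominator. For k = 0 it is 1, which cancels the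
   one-letter words; for k = 1 it is 0 because [0]_t = 0. *)
rewrite (eq_bigr (fun c : 'I_N =>
    (if k is 0 then 1 else - (t * qnum k.-1)) * (y c * elem_sym (delete y c) N k))).
  rewrite -big_distrr /= sum_elem_sym_delete.
  case: k => [|k]; first by rewrite /= /qnum big_ord1; ring.
  by rewrite /= subSS subn1 -mulr_natr; ring.
move=> c _; rewrite fcoefB; case: k => [|[|k]] /=.
- by rewrite elem_sym0; ring.
- by rewrite /qnum big_ord0; ring.
- by rewrite subn1; ring.
Qed.

End FiniteAlphabet.

(** * Words over a finite alphabet *)

Section Words.
Implicit Types (w : seq nat) (N n a : nat).

Fixpoint words N n : seq (seq nat) :=
  if n is n'.+1 then [seq a :: w | a <- iota 0 N, w <- words N n'] else [:: [::]].

Lemma mem_words N n w :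
  (w \in words N n) = (size w == n) && all (fun a => a < N)%N w.
Proof.
elim: n w => [|n IHn] [|a w] //=.
  by apply/allpairsP => -[[b v] [_ _]].
rewrite eqSS; apply/allpairsP/idP => [[[b v] /= [+ + [-> ->]]]|].
  by rewrite mem_iota IHn /= => -> /andP[-> ->].
move=> /and3P[sw aN wN]; exists (a, w); rewrite mem_iota IHn sw wN.
by split.
Qed.

Lemma uniq_words N n : uniq (words N n).
Proof.
elim: n => // n IHn; apply: allpairs_uniq; rewrite ?iota_uniq //.
by move=> [a v] [b w] _ _ [-> ->].
Qed.

Definition ndes w := count (fun p => p.2 < p.1)%N (zip w (behead w)).

Definition nsmirnov w := sorted (fun a b => a != b) w.

Definition nends_differ w := if w is a :: u then a != last a u else false.

Variables (R : comNzRingType) (t : R).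
Implicit Types (f y : nat -> R).

Lemma word_sumE f y N n a : word_sum t f y N n a =
  \sum_(w <- words N n | nsmirnov (a :: w))
    t ^+ ndes (a :: w) * ((\prod_(b <- belast a w) y b) * f (last a w)).
Proof.
elim: n a => [|n IHn] a; first by rewrite big_cons !big_nil /= expr0 !mul1r addr0.
rewrite big_mkcond /= big_allpairs_dep /=.
rewrite (_ : iota 0 N = index_iota 0 N); last by rewrite /index_iota subn0.
rewrite big_mkord big_distrr /= [LHS]big_mkcond; apply: eq_bigr => b _.
case: (eqVneq (b : nat) a) => [->|neq_ba].
  by rewrite big1 // => w _; rewrite /nsmirnov /= eqxx.
rewrite IHn mulrCA !big_distrr /= big_mkcond /=; apply: eq_bigr => w _.
rewrite /nsmirnov /=; case: ifP => // _; rewrite big_cons {2}/ndes /= exprD.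
by rewrite -/(ndes (nat_of_ord b :: w)); case: ifP => _ /=; rewrite ?expr1 ?expr0; ring.
Qed.

Lemma ends_differ_words y N n : fcoef (ends_differ_series t y N) n =
  \sum_(w <- words N n | nsmirnov w && nends_differ w)
    t ^+ ndes w * \prod_(b <- w) y b.
Proof.
rewrite fcoefB !fcoef_sum /=; case: n => [|n].
  by rewrite !big1_eq subrr big_cons !big_nil.
rewrite [RHS]big_mkcond /= big_allpairs_dep /=.
rewrite (_ : iota 0 N = index_iota 0 N); last by rewrite /index_iota subn0.
rewrite big_mkord -sumrB; apply: eq_bigr => a _; rewrite !word_sumE.
rewrite -sumrB big_mkcond; apply: eq_bigr => w _ /=.
rewrite lastI big_rcons -lastI /= /nsmirnov /=; case: ifP => //= _.
(* The subtracted word has last weight [y a] if it ends in [a] and 0 otherwise. *)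
by rewrite /single eq_sym; case: eqP => [<-|_] /=; ring.
Qed.

End Words.

(** * Truncation of power series in many indeterminates *)

Section Truncation.
Variables (I : choiceType) (R : comNzRingType) (S : pred I).
Implicit Types (f g : mps I R) (m : {cmonom I}).

Definition msupported m := all S (finsupp m).

Lemma msupportedP m : reflect (forall i, m i != 0%N -> S i) (msupported m).
Proof.
by apply: (iffP allP) => mS i; [rewrite cmE_neq0; apply: mS|rewrite -cmE_neq0; apply: mS].
Qed.

Lemma msupportedM m1 m2 :
  msupported (mmul m1 m2) = msupported m1 && msupported m2.
Proof.
apply/msupportedP/andP => [mS|[/msupportedP m1S /msupportedP m2S] i].
  by split; apply/msupportedP => i mi; apply: mS; rewrite cmM addn_eq0 negb_and mi ?orbT.
by rewrite cmM addn_eq0 negb_and => /orP[/m1S|/m2S].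
Qed.

Lemma msupported1 : msupported mone.
Proof. by rewrite /msupported mdom1. Qed.

(** The substitution of 0 for every indeterminate outside [S]. *)
Definition mps_trunc f : mps I R :=
  MPS (fun m => if msupported m then mcoef f m else 0).

Lemma mcoef_trunc f m :
  mcoef (mps_trunc f) m = if msupported m then mcoef f m else 0.
Proof. by []. Qed.

Fact mps_trunc_is_zmod_morphism : zmod_morphism mps_trunc.
Proof. by move=> f g; apply: mpsP => m /=; case: ifP => //; rewrite subr0. Qed.

(** A product of monomials is supported in [S] exactly when both factors are, so truncation respects
    convolution. *)
Fact mps_trunc_is_monoid_morphism : monoid_morphism mps_trunc.
Proof.
split=> [|f g]; apply: mpsP => m.
  by rewrite /=; case: (eqVneq m mone) => [->|_]; rewrite ?msupported1 // if_same.
rewrite [RHS]mps_mulE /= fsbig_finite; last exact: finite_msplit.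
case: ifP => mS; last first.
  rewrite big1_seq // => -[m1 m2] /=; rewrite mem_msplits /= => /eqP m12.
  by move: mS; rewrite -m12 msupportedM; do 2!case: ifP => //; rewrite ?mulr0 ?mul0r.
apply: eq_big_seq => -[m1 m2]; rewrite mem_msplits /= => /eqP m12.
by move: mS; rewrite -m12 msupportedM => /andP[-> ->].
Qed.

HB.instance Definition _ :=
  GRing.isZmodMorphism.Build (mps I R) (mps I R) mps_trunc mps_trunc_is_zmod_morphism.
HB.instance Definition _ :=
  GRing.isMonoidMorphism.Build (mps I R) (mps I R) mps_trunc mps_trunc_is_monoid_morphism.

Definition mmonom m : mps I R := MPS (fun m' => (m' == m)%:R).

Lemma mmul_injr m1 : injective (mmul m1).
Proof.
move=> a b /(congr1 (fun c : {cmonom I} => c : _ -> _)) eq_ab.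
apply/eqP/cmP => i; move/(congr1 (fun c => c i)): eq_ab.
by rewrite !cmM => /addnI.
Qed.

Lemma mcoef_mmonomM m1 f m : mcoef (mmonom m1 * f) (mmul m1 m) = mcoef f m.
Proof.
rewrite mps_mulE (bigD1_seq (m1, m)) ?fset_uniq ?mem_msplits //= eqxx mul1r.
rewrite big1_seq ?addr0 // => -[a b]; rewrite mem_msplits /= xpair_eqE negb_and.
case: (eqVneq a m1) => [->|] /=; last by rewrite mul0r.
by case/andP=> neq_bm /eqP/mmul_injr eq_bm; rewrite eq_bm eqxx in neq_bm.
Qed.

Lemma mcoef_mmonomM0 m1 f m :
  (forall m', m <> mmul m1 m') -> mcoef (mmonom m1 * f) m = 0.
Proof.
move=> nm; rewrite mps_mulE big1_seq // => -[a b]; rewrite mem_msplits /=.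
case: (eqVneq a m1) => [->|] /=; last by rewrite mul0r.
by move=> /eqP eqm; case: (nm b).
Qed.

Lemma mmonomM m1 m2 : mmonom m1 * mmonom m2 = mmonom (mmul m1 m2).
Proof.
apply: mpsP => m; have [[m' ->]|nm] := pselect (exists m', m = mmul m1 m').
  by rewrite mcoef_mmonomM [RHS]/= (inj_eq (@mmul_injr m1)).
rewrite mcoef_mmonomM0 => [|m' eqm]; last by apply: nm; exists m'.
by rewrite [RHS]/=; case: eqP => // eqm; case: nm; exists m2.
Qed.

Lemma mmonom1 : mmonom mone = 1. Proof. exact: mpsP. Qed.

Lemma mmonom_prod (J : Type) (s : seq J) (F : J -> {cmonom I}) :
  \prod_(j <- s) mmonom (F j) = mmonom (\big[mmul/mone]_(j <- s) F j).
Proof. by elim/big_rec2: _ => [|j m f _ ->]; rewrite ?mmonom1 ?mmonomM. Qed.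

End Truncation.

(** * Restriction to the letters 1, .., N *)

Lemma elemsymP (I : choiceType) k (m : {cmonom I}) :
  mcoef (elemsym I k) m = ((mdeg m == k) && `[<forall i, (m i <= 1)%N>])%:R.
Proof.
congr (_ && _)%:R; apply/allP/asboolP => [m1 i|m1 i].
  by case: (boolP (i \in finsupp m)) => [/m1/eqP ->|]; rewrite // -cmE_eq0 => /eqP ->.
by rewrite -cmE_neq0 => mi; move: (m1 i) mi; case: (m i) => [|[]].
Qed.

(** The shift from indices starting at 0 to positive letters; it preserves order, hence descents. *)
Definition letter_of (i : nat) : letter := exist _ i.+1 isT.

Definition letters_le N : pred letter := fun a => (val a <= N)%N.

Definition letter_mon i : mps letter int := mmonom int (ucm (letter_of i)).

Lemma letter_ofK (a : letter) : letter_of (val a).-1 = a.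
Proof. by apply: val_inj => /=; rewrite prednK //; exact: (valP a). Qed.

Lemma letter_of_inj : injective letter_of.
Proof. by move=> i j /(congr1 val) []. Qed.

Lemma letters_leS N a : letters_le N.+1 a = letters_le N a || (a == letter_of N).
Proof. by rewrite /letters_le leq_eqVlt ltnS orbC -val_eqE. Qed.

Lemma mcoefD (f g : mps letter int) m : mcoef (f + g) m = mcoef f m + mcoef g m.
Proof. by []. Qed.

(** The truncations satisfy the recurrence defining [elem_sym]: a monomial either avoids the newest
    letter [u] or is [u] times a monomial that must avoid it. *)
Lemma trunc_elemsym N k :
  mps_trunc (letters_le N) (elemsym letter k) = elem_sym letter_mon N k.
Proof.
elim: N k => [|N IHN] [|k]; try by rewrite elem_sym0; apply: mpsP => m;
  rewrite mcoef_trunc elemsymP mdeg_eq0 /=; case: eqP => [->|];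
  rewrite ?if_same // msupported1 (asboolT _) // => i; rewrite cm1.
  apply: mpsP => m; rewrite mcoef_trunc elemsymP; case: ifP => // /msupportedP m0.
  rewrite (_ : m = mone) ?mdeg1 //; apply/eqP/cmP => i; rewrite cm1.
  apply/eqP; apply: contraT => /m0; rewrite /letters_le leqNgt.
  by rewrite (valP i).
rewrite /= -!IHN; apply: mpsP => m; set u := letter_of N; rewrite mcoefD.
case: (eqVneq (m u) 0%N) => [mu0|mu_neq0].
  rewrite mcoef_mmonomM0 ?addr0 => [|m' eqm]; last first.
    by move: mu0; rewrite eqm cmM cmUU.
  rewrite !mcoef_trunc; congr (if _ then _ else _); apply: eq_in_all => i.
  rewrite -cmE_neq0 letters_leS -/u; case: (eqVneq i u) => [->|]; rewrite ?orbF //.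
  by rewrite mu0.
pose m' := divcm m (ucm u); have defm : m = mmul (ucm u) m'.
  apply/eqP/cmP => i; rewrite cmM divcmE cmU; case: eqP => [<-|_]; last by rewrite subn0.
  by rewrite subnKC // lt0n.
rewrite defm mcoef_mmonomM !mcoef_trunc !elemsymP !msupportedM mdegM mdegU eqSS.
have suppu j : msupported (letters_le j) (ucm u) = (N < j)%N.
  apply/msupportedP/idP => [/(_ u)|ltNj i]; first by rewrite cmUU; apply.
  by rewrite cmU; case: (u =P i) => [<-|].
rewrite !suppu ltnn ltnSn add0r /=.
have ones : (forall i, (mmul (ucm u) m' i <= 1)%N) <->
    (forall i, (m' i <= 1)%N) /\ m' u = 0%N.
  split=> [le1|[le1 m'u] i].
    split=> [i|]; last by have := le1 u; rewrite cmM cmUU; case: (m' u).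
    by apply: leq_trans (le1 i); rewrite cmM leq_addl.
  rewrite cmM cmU; case: (u =P i) => [<-|_]; last exact: le1.
  by rewrite m'u.
have supp : m' u = 0%N ->
    msupported (letters_le N.+1) m' = msupported (letters_le N) m'.
  move=> m'u; apply: eq_in_all => i.
  rewrite -cmE_neq0 letters_leS -/u; case: (eqVneq i u) => [->|]; rewrite ?orbF //.
  by rewrite m'u.
case: (eqVneq (m' u) 0%N) => [m'u|m'u].
  rewrite supp //; congr (if _ then (_ && _)%:R else _).
  by apply/asboolP/asboolP => [/ones[]|] // le1; apply/ones.
rewrite (asboolF (_ : ~ _)) ?andbF ?if_same; last by case/ones => _ /eqP; apply/negP.
case: ifP => // /msupportedP /(_ u m'u); by rewrite /letters_le ltnn.
Qed.

Lemma mcoef_sum (J : Type) (s : seq J) (P : pred J) (F : J -> mps letter int) m :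
  mcoef (\sum_(j <- s | P j) F j) m = \sum_(j <- s | P j) mcoef (F j) m.
Proof. by elim/big_rec2: _ => // j x f _ <-. Qed.

Lemma des_letter_of w : des (map letter_of w) = ndes w.
Proof.
rewrite /des /ndes; elim: w => [|a [|b w] IHw] //=.
by move: IHw => /= ->.
Qed.

Lemma smirnov_letter_of n w :
  smirnov n (map letter_of w) = (size w == n) && nsmirnov w.
Proof.
by rewrite /smirnov size_map sorted_map; congr (_ && _).
Qed.

Lemma ends_differ_letter_of w : ends_differ (map letter_of w) = nends_differ w.
Proof. by case: w => //= a w; rewrite last_map (inj_eq letter_of_inj). Qed.

Lemma xmon_supported N w :
  msupported (letters_le N) (xmon (map letter_of w)) = all (fun a => a < N)%N w.
Proof.
elim: w => [|a w IHw]; first by rewrite /xmon big_nil msupported1.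
rewrite /xmon big_cons msupportedM -/(xmon _) IHw /=; congr (_ && _).
apply/msupportedP/idP => [/(_ (letter_of a))|aN i]; first by rewrite cmUU; apply.
by rewrite cmU; case: (letter_of a =P i) => [<-|].
Qed.

Lemma letter_of_words N n (w : seq letter) : size w = n ->
  msupported (letters_le N) (xmon w) ->
  exists2 v, v \in words N n & w = map letter_of v.
Proof.
move=> sw; have -> : w = map letter_of [seq (val a).-1 | a <- w].
  by rewrite -map_comp -[LHS]map_id; apply: eq_map => a /=; rewrite letter_ofK.
rewrite xmon_supported => all_le; exists [seq (val a).-1 | a <- w] => //.
by rewrite mem_words size_map sw eqxx.
Qed.

Definition pletter i : {poly mps letter int} := (letter_mon i)%:P.

(** A word whose monomial involves only letters up to N is itself a word over those letters, so both
    coefficients count the same words. *)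
Lemma trunc_Wne N n : (0 < n)%N ->
  map_poly (mps_trunc (letters_le N)) (Wne n) =
  fcoef (ends_differ_series 'X pletter N) n.
Proof.
move=> n_gt0; apply/polyP => j; rewrite coef_map ends_differ_words coef_sum.
apply: mpsP => m; rewrite mcoef_trunc coef_Wne // mcoef_sum.
have termE w : mcoef (('X^(ndes w) * \prod_(b <- w) pletter b)`_j) m =
    ((ndes w == j) && (xmon (map letter_of w) == m))%:R.
  rewrite -rmorph_prod coefMC coefXn mmonom_prod eq_sym.
  by case: eqP => _; rewrite ?mul1r ?mul0r //= /xmon big_map eq_sym.
under [RHS]eq_bigr => w _ do rewrite termE mulrb.
rewrite -big_mkcondr /=.
case: ifP => [mS|mS]; last first.
  rewrite big_seq_cond big1 // => w /andP[wN].
  case/andP=> _ /andP[_ /eqP eqm]; move: mS wN.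
  by rewrite -eqm xmon_supported mem_words => ->; rewrite andbF.
rewrite -[RHS]big_filter; set s := [seq w <- words N n | _].
transitivity (\sum_(w <- map (map letter_of) s) (1 : int)); last by rewrite big_map.
rewrite [RHS]fsbig_seq; last first.
  by rewrite map_inj_uniq ?filter_uniq ?uniq_words //; apply: inj_map; exact: letter_of_inj.
apply: eq_fsbigl; apply/seteqP; split => w /=.
  case=> sm ed dj xm; have /andP[/eqP sw _] := sm.
  have [|v vN defw] := @letter_of_words N n w sw; first by rewrite xm.
  move: sm ed dj xm; rewrite defw smirnov_letter_of ends_differ_letter_of des_letter_of.
  move=> /andP[_ nsm] ned dj xm.
  rewrite mem_map; last by apply: inj_map; exact: letter_of_inj.
  by rewrite mem_filter nsm ned vN dj xm !eqxx.
case/mapP=> v; rewrite mem_filter => /andP[/andP[/andP[nsm ned] /andP[/eqP dv /eqP xv]]].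
rewrite mem_words => /andP[sv _] ->.
by rewrite smirnov_letter_of ends_differ_letter_of des_letter_of nsm ned sv.
Qed.

(** * The identity over the infinite alphabet *)

Definition fps_map (R1 R2 : comNzRingType) (phi : {rmorphism R1 -> R2}) (g : fps R1) :=
  FPS (fun n => phi (fcoef g n)).

Lemma fps_mapM (R1 R2 : comNzRingType) (phi : {rmorphism R1 -> R2}) (g h : fps R1) :
  fps_map phi (g * h) = fps_map phi g * fps_map phi h.
Proof.
apply: fpsP => n; rewrite /= rmorph_sum; apply: eq_bigr => i _.
by rewrite rmorphM.
Qed.

Definition den_series : fps {poly mps letter int} :=
  1 - series_from 2 (fun i => 'X * tnum _ (i - 1) * (elemsym letter i)%:P).

Definition num_series : fps {poly mps letter int} :=
  series_from 2 (fun i =>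
    (tnum _ i + i%:R * 'X * tnum _ (i - 2)) * (elemsym letter i)%:P).

Definition ptrunc N : {rmorphism {poly mps letter int} -> {poly mps letter int}} :=
  map_poly (mps_trunc (letters_le N)).

Lemma ptrunc_qnum N k : ptrunc N (tnum _ k) = qnum 'X k.
Proof.
rewrite /ptrunc /= /tnum /qnum rmorph_sum; apply: eq_bigr => i _.
exact: map_polyXn.
Qed.

Lemma elem_sym_polyC N k : elem_sym pletter N k = (elem_sym letter_mon N k)%:P.
Proof.
elim: N k => [|N IHN] [|k] //=; rewrite ?polyC0 //.
by rewrite !IHN /pletter polyCD polyCM.
Qed.

Lemma ptrunc_elemsym N k : ptrunc N (elemsym letter k)%:P = elem_sym pletter N k.
Proof. by rewrite /ptrunc /= map_polyC /= trunc_elemsym elem_sym_polyC. Qed.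

Lemma ptrunc_den N : fps_map (ptrunc N) den_series = smirnov_den 'X pletter N.
Proof.
apply: fpsP => n; rewrite [LHS]/= !fcoefB rmorphB /=; congr (_ - _).
  by case: n => [|n]; rewrite ?rmorph1 ?rmorph0.
case: ifP => _; last by rewrite rmorph0.
rewrite -ptrunc_elemsym -(ptrunc_qnum N) [LHS]rmorphM (rmorphM (ptrunc N) 'X).
by rewrite [ptrunc N 'X]map_polyX.
Qed.

Lemma ptrunc_num N : fps_map (ptrunc N) num_series = smirnov_num 'X pletter N.
Proof.
apply: fpsP => n; rewrite /=; case: ifP => _; last by rewrite rmorph0.
rewrite -ptrunc_elemsym -!(ptrunc_qnum N).
rewrite [LHS]rmorphM [X in X * _]rmorphD !(rmorphM (ptrunc N) _ (tnum _ _)).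
by rewrite (rmorphM (ptrunc N) _ 'X) rmorph_nat [ptrunc N 'X]map_polyX.
Qed.

Lemma ptrunc_Wne N :
  fps_map (ptrunc N) (series_from 1 Wne) = ends_differ_series 'X pletter N.
Proof.
apply: fpsP => -[|n]; last by rewrite -trunc_Wne.
by rewrite ends_differ_words big_cons !big_nil [LHS]rmorph0.
Qed.

(** A monomial has finitely many letters, so truncating at its largest letter keeps its
    coefficient. *)
Lemma fps_ptrunc_inj (g h : fps {poly mps letter int}) :
  (forall N, fps_map (ptrunc N) g = fps_map (ptrunc N) h) -> g = h.
Proof.
move=> eq_gh; apply: fpsP => n; apply/polyP => j; apply: mpsP => m.
pose N := (\max_(a <- finsupp m) val a)%N.
have mN : msupported (letters_le N) m.
  by apply/allP => a am; rewrite /letters_le /N (big_fsetD1 a) //= leq_maxl.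
move/(congr1 (fun k : fps {poly mps letter int} => mcoef (fcoef k n)`_j m)): (eq_gh N).
by rewrite /= !coef_map /= mN.
Qed.

Lemma Wne_seriesM : series_from 1 Wne * den_series = num_series.
Proof.
apply: fps_ptrunc_inj => N.
by rewrite fps_mapM ptrunc_Wne ptrunc_den ptrunc_num ends_differ_seriesM.
Qed.

(** * e-positivity *)

Section SymmetricFunctionClosure.
Variable I : choiceType.
Implicit Types (f g : mps I int) (m : {cmonom I}).

(** The monomial [m] with x_i renamed to x_(s i), for [s'] the inverse of [s]. *)
Definition relabel (s s' : I -> I) m : {cmonom I} :=
  mkcmonom [fsfun i in [fset s x | x in finsupp m]%fset => m (s' i) | 0%N].

Lemma relabelE s s' m i : cancel s' s -> relabel s s' m i = m (s' i).
Proof.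
move=> s'K; rewrite /relabel cmE fsfunE; case: ifP => // /negbT im.
apply/esym/eqP; rewrite cmE_eq0; apply: contra im => im.
by rewrite -[i]s'K in_imfset.
Qed.

Lemma relabelK s s' m : cancel s s' -> cancel s' s ->
  relabel s' s (relabel s s' m) = m.
Proof. by move=> sK s'K; apply/eqP/cmP => i; rewrite !relabelE ?sK. Qed.

Lemma relabelM s s' m1 m2 : cancel s' s ->
  relabel s s' (mmul m1 m2) = mmul (relabel s s' m1) (relabel s s' m2).
Proof. by move=> s'K; apply/eqP/cmP => i; rewrite cmM !relabelE ?cmM. Qed.

Lemma mdeg_relabel s s' m : cancel s s' -> cancel s' s ->
  mdeg (relabel s s' m) = mdeg m.
Proof.
move=> sK s'K; rewrite !mdegE (perm_big [seq s x | x <- finsupp m]) /=.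
  by rewrite big_map; apply: eq_bigr => i _; rewrite relabelE ?sK.
apply: uniq_perm; rewrite ?fset_uniq ?(map_inj_uniq (can_inj sK)) ?fset_uniq // => i.
rewrite -[i in RHS]s'K (mem_map (can_inj sK)).
by rewrite -!cmE_neq0 relabelE.
Qed.

Lemma symmetric_functionE f : symmetric_function f <->
  (exists d : nat, forall m, (d < mdeg m)%N -> mcoef f m = 0) /\
  (forall s s', cancel s s' -> cancel s' s -> forall m,
     mcoef f (relabel s s' m) = mcoef f m).
Proof.
split=> -[fd fs]; split=> // s.
  move=> s' sK s'K m; apply: (fs s); first by exists s'.
  by move=> i; rewrite relabelE ?sK.
case=> s' sK s'K m m' eqm; rewrite -(fs s s' sK s'K m); congr (mcoef f _).
by apply/eqP/cmP => i; rewrite relabelE // -eqm s'K.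
Qed.

Lemma symmetric_functionD f g : symmetric_function f -> symmetric_function g ->
  symmetric_function (f + g).
Proof.
move=> [[d fd] fs] [[e ge] gs]; split.
  by exists (maxn d e) => m; rewrite gtn_max => /andP[dm em] /=; rewrite fd ?ge ?addr0.
by move=> s bs m m' eqm /=; rewrite (fs s bs m) ?(gs s bs m).
Qed.

Lemma symmetric_functionM f g : symmetric_function f -> symmetric_function g ->
  symmetric_function (f * g).
Proof.
move=> /symmetric_functionE[[d fd] fs] /symmetric_functionE[[e ge] gs].
apply/symmetric_functionE; split.
  exists (d + e)%N => m dem; rewrite mps_mulE big1_seq // => -[a b].
  rewrite mem_msplits /= => /eqP abm; move: dem; rewrite -abm mdegM => dem.
  have [da|ad] := ltnP d (mdeg a); first by rewrite fd ?mul0r.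
  by rewrite (ge b) ?mulr0 // -(ltn_add2l d); apply: leq_trans dem _; rewrite leq_add2r.
move=> s s' sK s'K m; rewrite !mps_mulE.
pose rel2 (p : {cmonom I} * {cmonom I}) := (relabel s s' p.1, relabel s s' p.2).
have rel2I : injective rel2.
  by apply: (can_inj (g := fun p => (relabel s' s p.1, relabel s' s p.2))) => -[a b];
    rewrite /= !relabelK.
rewrite (perm_big [seq rel2 p | p <- msplits m]) /=.
  by rewrite big_map; apply: eq_bigr => p _; rewrite fs ?gs.
apply: uniq_perm; rewrite ?fset_uniq ?map_inj_uniq ?fset_uniq // => -[a b].
rewrite -[a](relabelK a s'K sK) -[b](relabelK b s'K sK).
rewrite (mem_map rel2I _ (relabel s' s a, relabel s' s b)) !mem_msplits /=.
rewrite -relabelM //; apply/eqP/eqP => [/(congr1 (relabel s' s))|->] //.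
by rewrite !relabelK.
Qed.

Lemma symmetric_function0 : symmetric_function (0 : mps I int).
Proof. by split=> //; exists 0%N. Qed.

Lemma symmetric_elemsym k : symmetric_function (elemsym I k).
Proof.
apply/symmetric_functionE; split.
  by exists k => m km; rewrite /= (gtn_eqF km).
move=> s s' sK s'K m; rewrite !elemsymP mdeg_relabel //; congr ((_ && _)%:R).
by apply/asboolP/asboolP => le1 i; [rewrite -[i]sK -(relabelE m _ s'K)|rewrite relabelE].
Qed.

Lemma symmetric_function1 : symmetric_function (1 : mps I int).
Proof.
suff -> : (1 : mps I int) = elemsym I 0 by exact: symmetric_elemsym.
apply: mpsP => m; rewrite elemsymP mdeg_eq0 /=; case: eqP => [->|//].
by rewrite asboolT // => i; rewrite cm1.
Qed.

Lemma symmetric_elemsym_part la : symmetric_function (elemsym_part I la).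
Proof.
apply: big_ind => [||k _]; [exact: symmetric_function1|exact: symmetric_functionM|].
exact: symmetric_elemsym.
Qed.

(* [e_positive], with coefficients recorded as multiplicities of partitions. *)
Definition elemsym_sum f := exists2 l : seq (seq nat),
  all is_partition l & f = \sum_(la <- l) elemsym_part I la.

Lemma elemsym_sum_e_positive f : elemsym_sum f -> e_positive f.
Proof.
case=> l lP ->; split.
  apply: big_ind => [||la _]; [exact: symmetric_function0|exact: symmetric_functionD|].
  exact: symmetric_elemsym_part.
exists (undup l), (fun la => (count_mem la l)%:Z); split.
- exact: undup_uniq.
- by apply/allP => la; rewrite mem_undup => /(allP lP).
- by [].
rewrite -big_undup_iterop_count; apply: eq_bigr => la _.
by rewrite -pmulrn.
Qed.

Lemma elemsym_sum0 : elemsym_sum 0.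
Proof. by exists [::]; rewrite ?big_nil. Qed.

Lemma elemsym_sumD f g : elemsym_sum f -> elemsym_sum g -> elemsym_sum (f + g).
Proof.
move=> [l lP ->] [k kP ->]; exists (l ++ k); first by rewrite all_cat lP.
by rewrite big_cat.
Qed.

Lemma elemsym_sum1 : elemsym_sum 1.
Proof. by exists [:: [::]]; rewrite // big_seq1 /elemsym_part big_nil. Qed.

Lemma elemsym_sum_elemsym k : (0 < k)%N -> elemsym_sum (elemsym I k).
Proof.
move=> k_gt0; exists [:: [:: k]]; first by rewrite /is_partition /= k_gt0.
by rewrite big_seq1 /elemsym_part big_seq1.
Qed.

(** The product of e_la and e_mu is e of the concatenation, sorted back into a partition. *)
Lemma elemsym_sumM f g : elemsym_sum f -> elemsym_sum g -> elemsym_sum (f * g).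
Proof.
move=> [l lP ->] [k kP ->].
exists [seq sort geq (la ++ mu) | la <- l, mu <- k].
  apply/allP => _ /allpairsP[[la mu] /= [/(allP lP) + /(allP kP) + ->]].
  move=> /andP[_ la0] /andP[_ mu0]; rewrite /is_partition sort_sorted.
    by rewrite all_sort all_cat la0.
  by move=> a b; rewrite /geq /= leq_total.
rewrite big_allpairs_dep big_distrl /=; apply: eq_bigr => la _.
rewrite big_distrr /=; apply: eq_bigr => mu _.
by rewrite /elemsym_part -big_cat; apply: perm_big; rewrite perm_sym perm_sort.
Qed.

Definition pelemsym_sum (P : {poly mps I int}) := forall j, elemsym_sum P`_j.

Lemma pelemsym_sum0 : pelemsym_sum 0.
Proof. by move=> j; rewrite coef0; exact: elemsym_sum0. Qed.

Lemma pelemsym_sumD P Q : pelemsym_sum P -> pelemsym_sum Q -> pelemsym_sum (P + Q).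
Proof. by move=> hP hQ j; rewrite coefD; exact: elemsym_sumD. Qed.

Lemma pelemsym_sum_sum (J : Type) (r : seq J) (C : pred J) (F : J -> {poly mps I int}) :
  (forall j, C j -> pelemsym_sum (F j)) -> pelemsym_sum (\sum_(j <- r | C j) F j).
Proof. by move=> hF; apply: big_ind; [exact: pelemsym_sum0|exact: pelemsym_sumD|]. Qed.

Lemma pelemsym_sumM P Q : pelemsym_sum P -> pelemsym_sum Q -> pelemsym_sum (P * Q).
Proof.
move=> hP hQ j; rewrite coefM; apply: big_ind.
- exact: elemsym_sum0.
- exact: elemsym_sumD.
- by move=> i _; exact: elemsym_sumM.
Qed.

Lemma pelemsym_sumC f : elemsym_sum f -> pelemsym_sum f%:P.
Proof. by move=> hf [|j]; rewrite coefC //=; exact: elemsym_sum0. Qed.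

Lemma pelemsym_sumXn k : pelemsym_sum 'X^k.
Proof.
by move=> j; rewrite coefXn; case: eqP => _; [exact: elemsym_sum1|exact: elemsym_sum0].
Qed.

Lemma pelemsym_sum_nat k : pelemsym_sum k%:R.
Proof.
rewrite -[k]card_ord -sumr_const; apply: pelemsym_sum_sum => i _.
exact: (pelemsym_sumXn 0).
Qed.

Lemma pelemsym_sum_tnum k : pelemsym_sum (tnum _ k).
Proof. by apply: pelemsym_sum_sum => i _; exact: pelemsym_sumXn. Qed.

End SymmetricFunctionClosure.

(** The coefficient of z^n in [Wne_seriesM], solved for [Wne n]. The convolution term i = n drops
    out because the subtracted series in the denominator has no constant term. *)
Lemma Wne_rec n : (0 < n)%N -> Wne n = fcoef num_series n +
  \sum_(i < n | (2 <= n - i)%N && (0 < i)%N)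
    Wne i * ('X * tnum _ (n - i - 1) * (elemsym letter (n - i))%:P).
Proof.
move=> n_gt0; set X := \sum_(i < n | _) _.
have -> : X = fcoef (series_from 1 Wne *
    series_from 2 (fun i => 'X * tnum _ (i - 1) * (elemsym letter i)%:P)) n.
  rewrite fcoefM big_ord_recr /= subnn mulr0 addr0 /X big_mkcond.
  apply: eq_bigr => i _.
  by case: (1 < n - i)%N; case: (0 < i)%N; rewrite /= ?mul0r ?mulr0.
by rewrite -Wne_seriesM mulrBr mulr1 fcoefB subrK /= n_gt0.
Qed.

(** Strong induction: the recurrence uses only sums and products of smaller [Wne i], powers of t,
    naturals and e_k with k >= 2. *)
Lemma Wne_elemsym_sum n : (0 < n)%N -> pelemsym_sum (Wne n).
Proof.
elim/ltn_ind: n => n IHn n_gt0; rewrite Wne_rec //; apply: pelemsym_sumD.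
  rewrite /=; case: ifP => [n2|_]; last exact: pelemsym_sum0.
  apply: pelemsym_sumM; last exact/pelemsym_sumC/elemsym_sum_elemsym.
  apply: pelemsym_sumD; first exact: pelemsym_sum_tnum.
  apply: pelemsym_sumM; last exact: pelemsym_sum_tnum.
  by apply: pelemsym_sumM; [exact: pelemsym_sum_nat|exact: (pelemsym_sumXn _ 1)].
apply: pelemsym_sum_sum => i /andP[ni i_gt0]; apply: pelemsym_sumM; first exact: IHn.
apply: pelemsym_sumM; last by apply/pelemsym_sumC/elemsym_sum_elemsym; exact: ltnW.
by apply: pelemsym_sumM; [exact: (pelemsym_sumXn _ 1)|exact: pelemsym_sum_tnum].
Qed.

Theorem corollary2p4 :
  series_from 1 Wne =
    series_from 2 (fun i =>
      (tnum _ i + i%:R * 'X * tnum _ (i - 2)) * (elemsym letter i)%:P)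
    * fpsV (1 - series_from 2 (fun i => 'X * tnum _ (i - 1) * (elemsym letter i)%:P))
  /\ forall n : nat, (1 <= n)%N -> poly_e_positive (Wne n).
Proof.
split.
  (* The denominator has constant term 1, so [fpsV] is its inverse. *)
  rewrite -/den_series -/num_series -Wne_seriesM -mulrA fpsVP ?mulr1 //.
  by rewrite fcoefB /= subr0.
by move=> n n_gt0 j; exact/elemsym_sum_e_positive/Wne_elemsym_sum.
Qed.
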